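(* Let $W$ be a bounded linear operator on $\mathcal H=l^2(\mathbb N_0,\mu)$ with matrix entries $W_{kj}$. Then $$\|W\|_\mu^2=\sum_{j,k\in\mathbb N_0}\mu_k|W_{kj}|^2,\qquad \|W\|_\mu\le\|W\|<\infty .$$
   Context: Let $\mathbb N_0=\{0,1,\dots\}$ and let $\mu_j>0$ ($j\in\mathbb N_0$) satisfy $\sum_j\mu_j=1$; for $X\subset\mathbb N_0$ put $\mu(X)=\sum_{j\in X}\mu_j$. $\mathcal H=l^2(\mathbb N_0,\mu)$ is the Hilbert space of complex sequences with $\langle x,y\rangle=\sum_j\mu_jx_j\overline{y_j}$ and $\|x\|=\sqrt{\langle x,x\rangle}$; $\|W\|$ is the operator norm of a bounded operator $W$ on $\mathcal H$. The matrix entries of $W$ are defined by $(Wx)_k=\sum_jW_{kj}x_j$. For $X\subset\mathbb N_0$, $\widehat{\mathbf 1}_X$ is the operator of multiplication by the indicator of $X$. A partition of $\mathbb N_0$ is a finite collection $\chi=\{Y_0,\dots,Y_J\}$ of pairwise disjoint subsets with union $\mathbb N_0$. Put $\mathcal M_\chi(W)=\sum_{j=0}^J\mu(Y_j)\|W\widehat{\mathbf 1}_{Y_j}\|^2$. The $\mu$-norm of $W$ is $\|W\|_\mu=\inf_\chi\sqrt{\mathcal M_\chi(W)}$, the infimum being over all partitions. *)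

(* Defs.v *)
From HB Require Import structures.
From mathcomp Require Import all_boot all_order all_algebra.
From mathcomp Require Import complex.
From mathcomp Require Import all_classical all_reals all_analysis.
From mathcomp Require Import lra.

Set Implicit Arguments.
Unset Strict Implicit.
Unset Printing Implicit Defensive.

Import Order.TTheory GRing.Theory Num.Theory.
Import numFieldNormedType.Exports.
Import ComplexField.Normc.

Local Open Scope classical_set_scope.
Local Open Scope ring_scope.
Local Open Scope complex_scope.

Lemma normc_ge0 (R : rcfType) (z : R[i]) : 0 <= normc z.
Proof. by case: z => a b; exact: sqrtr_ge0. Qed.

Lemma cvg_complex_sqr (R : realType) (u : nat -> R[i]) (l : R[i])
    (c : R) (t : nat -> R) :
  (forall n, normc (l - u n) ^+ 2 <= c * t n) -> t @ \oo --> (0 : R) ->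
  (u : nat -> R[i]^o) @ \oo --> (l : R[i]^o).
Proof.
move=> ult t0; apply/cvgrPdist_lt => e e0.
have [e'0 eE] : 0 < complex.Re e /\ e = (complex.Re e)%:C.
  move: e0; rewrite ltcE/= => /andP[/eqP ime ree]; split => //.
  by case: e ime ree => a b /= ->.
have ct0 : c * t n @[n --> \oo] --> (0 : R)
  by rewrite -(mulr0 c); apply: cvgM => //; exact: cvg_cst.
have /cvgrPdist_lt/(_ (complex.Re e ^+ 2)) := ct0.
move=> /(_ (exprn_gt0 _ e'0)); apply: filterS => n.
rewrite sub0r normrN => ctn.
have : normc (l - u n) < complex.Re e.
  rewrite -(@ltr_pXn2r _ 2)// ?nnegrE ?normc_ge0// ?ltW//.
  by rewrite (le_lt_trans (ult n))// (le_lt_trans (ler_norm _)).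
rewrite {2}eE -ltcR => h; apply: le_lt_trans h.
by case: (l - u n) => a b; rewrite lexx.
Qed.

Definition square_summable (R : realType) (mu : nat -> R) :
    {pred nat -> R[i]} :=
  [pred x : nat -> R[i] |
    `[< summable [set: nat] (fun j => (mu j * normc (x j) ^+ 2)%:E) >]].

Section square_summable_closed.
Context {R : realType} {mu : nat -> R}.

Lemma square_summable_dominated (c : R) (y x1 x2 : nat -> R[i]) :
  x1 \in square_summable mu -> x2 \in square_summable mu -> 0 <= c ->
  (forall j, normc (y j) ^+ 2 <=
     c * (normc (x1 j) ^+ 2 + normc (x2 j) ^+ 2)) ->
  y \in square_summable mu.
Proof.
move=> /asboolP s1 /asboolP s2 c0 le_y; apply/asboolP.
have /le_lt_trans : ((\esum_(j in [set: nat]) `|(mu j * normc (y j) ^+ 2)%:E| <=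
  c%:E * \esum_(j in [set: nat])
    (`|(mu j * normc (x1 j) ^+ 2)%:E| + `|(mu j * normc (x2 j) ^+ 2)%:E|))%E)%R.
  rewrite -!nneseries_esumT//; last by move=> n; rewrite adde_ge0.
  rewrite -nneseriesZl//; last by move=> n _; rewrite adde_ge0.
  apply: lee_nneseries => // j _.
  rewrite !abse_EFin -EFinD -EFinM lee_fin !(normrM (mu j)) -mulrDr.
  rewrite [leRHS]mulrCA ler_wpM2l// !(ger0_norm (sqr_ge0 _)).
  exact: le_y.
apply; rewrite esumD//.
by rewrite lte_mul_pinfty ?lee_fin// lte_add_pinfty.
Qed.

Fact square_summable0 : 0 \in square_summable mu.
Proof.
apply/asboolP; rewrite /summable esum1// => j _.
by rewrite [X in normc X](_ : _ = 0)// normc0 expr0n mulr0 abse0.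
Qed.

Fact square_summable_submod : GRing.submod_closed (square_summable mu).
Proof.
split=> [|a x y sx sy]; first exact: square_summable0.
pose b := normc a.
have b0 : 0 <= b by exact: normc_ge0.
apply: (square_summable_dominated (c := 2 * (b ^+ 2 + 1)) sx sy) => [|j].
  by rewrite mulr_ge0// addr_ge0// sqr_ge0.
have -> : (a *: x + y) j = a * x j + y j by [].
apply: (@le_trans _ _ ((b * normc (x j) + normc (y j)) ^+ 2)).
  rewrite lerXn2r ?nnegrE// ?addr_ge0 ?mulr_ge0 ?normc_ge0//.
  by rewrite -normcM; exact: le_normcD.
set u := normc (x j); set v := normc (y j).
have := sqr_ge0 (b * u - v).
have := sqr_ge0 (b * v).
have := sqr_ge0 u.
by nra.
Qed.

HB.instance Definition _ := GRing.isSubmodClosed.Build R[i] (nat -> R[i])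
  (square_summable mu) square_summable_submod.
End square_summable_closed.

Record l2 (R : realType) (mu : nat -> R) := L2 {
  l2_val :> nat -> R[i];
  _ : l2_val \in square_summable mu }.

HB.instance Definition _ (R : realType) (mu : nat -> R) :=
  [isSub for @l2_val R mu].
HB.instance Definition _ (R : realType) (mu : nat -> R) :=
  [Choice of l2 mu by <:].
HB.instance Definition _ (R : realType) (mu : nat -> R) :=
  [SubChoice_isSubLmodule of l2 mu by <:].

Section l2_space.
Context {R : realType} {mu : nat -> R}.
Implicit Types (x y : l2 mu) (X : set nat) (A : l2 mu -> l2 mu).

(* [R[i]^o] is [R[i]] with its norm topology, that of the complex plane. *)
Definition l2_dot x y : R[i] :=
  limn (series (fun j => (mu j)%:C * x j * ((y j)^*)%C) : nat -> R[i]^o).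

Definition l2_norm x : R := Num.sqrt (complex.Re (l2_dot x x)).

Lemma l2_norm_ge0 x : 0 <= l2_norm x.
Proof. exact: sqrtr_ge0. Qed.

Lemma l2_normE (mu0 : forall j, 0 <= mu j) x :
  series (fun j => mu j * normc (x j) ^+ 2) @ \oo --> l2_norm x ^+ 2.
Proof.
set u := fun j => _.
have u0 j : 0 <= u j by rewrite mulr_ge0// sqr_ge0.
have cu : cvgn (series u).
  have := valP x => /asboolP sx.
  apply: (@summable_cvg _ xpredT (fun j => (u j)%:E)) => //.
    by move=> i _; rewrite lee_fin.
  by rewrite [X in summable X](_ : _ = [set: nat])//; apply/seteqP; split.
have s0 : 0 <= limn (series u).
  by apply: (limr_ge cu); exists 0%N => //= n _; rewrite sumr_ge0.
suff -> : l2_norm x ^+ 2 = limn (series u) by [].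
rewrite /l2_norm (_ : l2_dot x x = (limn (series u))%:C) ?sqr_sqrtr//.
apply: (@cvg_lim (R[i]^o)); first exact: norm_hausdorff.
apply: (@cvg_complex_sqr _ _ _ 1 (fun n => (limn (series u) - series u n) ^+ 2)).
  move=> n; rewrite mul1r.
  rewrite (_ : series _ n = (series u n)%:C); last first.
    rewrite /series/= rmorph_sum/=; apply: eq_bigr => j _.
    by rewrite -mulrA -sqr_normc [RHS]rmorphM/= rmorphXn.
  by rewrite -rmorphB/= expr0n/= addr0 sqrtr_sqr real_normK// num_real.
rewrite -[X in _ --> X](_ : (limn (series u) - limn (series u)) *
  (limn (series u) - limn (series u)) = 0); last by rewrite subrr mulr0.
by apply: cvgM; apply: cvgB => //; exact: cvg_cst.
Qed.

Fact ind_mul_subproof X x :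
  (fun j => \1_X j * x j) \in square_summable mu.
Proof.
apply: (square_summable_dominated (c := 1) (valP x) (valP x)) => // j.
rewrite mul1r normcM exprMn indicE; case: (_ \in _); rewrite ?mulr1n ?mulr0n.
  by rewrite normc1 expr1n mul1r lerDl sqr_ge0.
by rewrite normc0 expr0n mul0r addr_ge0// sqr_ge0.
Qed.

Definition ind_mul X x : l2 mu := L2 (ind_mul_subproof X x).

Fact ind_mul_is_linear X : linear (ind_mul X).
Proof.
move=> a x y; apply/val_inj/funext => j /=.
by rewrite [RHS]/(_ + _)/= mulrDr mulrCA.
Qed.

HB.instance Definition _ X :=
  GRing.isLinear.Build R[i] (l2 mu) (l2 mu) _ (ind_mul X) (ind_mul_is_linear X).

Definition bounded_operator A : Prop :=
  exists M : R, forall x, l2_norm (A x) <= M * l2_norm x.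

(* The value is [+oo] when [A] is linear and unbounded. *)
Definition op_norm A : \bar R :=
  ereal_sup [set (l2_norm (A x))%:E | x in [set x | l2_norm x <= 1]].

Definition matrix_entries A (a : nat -> nat -> R[i]) : Prop :=
  forall x k,
    (series (fun j => a k j * x j) : nat -> R[i]^o) @ \oo --> (A x k : R[i]^o).

End l2_space.

Arguments ind_mul {R mu} X x : simpl never.

Section matrix_entries_existence.
Context {R : realType} {mu : nat -> R} (mu_gt0 : forall j, 0 < mu j).
Implicit Types x y : l2 mu.

Let mu_ge0 j : 0 <= mu j. Proof. exact: ltW. Qed.

Lemma l2_coord_le x k : mu k * normc (x k) ^+ 2 <= l2_norm x ^+ 2.
Proof.
have cx := @l2_normE R mu mu_ge0 x.
rewrite -(cvg_lim _ cx)//.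
have nd : nondecreasing_seq (series (fun j => mu j * normc (x j) ^+ 2)).
  apply/nondecreasing_seqP => n; rewrite seriesSr lerDl.
  by rewrite mulr_ge0// sqr_ge0.
apply: le_trans (nondecreasing_cvgn_le nd (cvgP _ cx) k.+1).
rewrite seriesSr lerDr sumr_ge0// => j _.
by rewrite mulr_ge0// sqr_ge0.
Qed.

Fact l2_basis_subproof (k : nat) :
  (fun j => (j == k)%:R : R[i]) \in square_summable mu.
Proof.
apply/asboolP; rewrite /summable -nneseries_esumT// (nneseriesD1 (n := k))//.
rewrite eseries0 ?adde0 ?ltry// => j _ /= jk.
by rewrite (negbTE jk) normc0 expr0n mulr0 normr0.
Qed.

Definition l2_basis (k : nat) : l2 mu := L2 (l2_basis_subproof k).

Lemma l2_sumE n (F : 'I_n -> l2 mu) k : (\sum_(i < n) F i) k = \sum_(i < n) F i k.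
Proof. by rewrite -[l2_val _]/(val _) (raddf_sum val) fct_sumE. Qed.

Lemma ind_mul_truncE x n :
  ind_mul `I_n x = \sum_(j < n) x j *: l2_basis j.
Proof.
apply/val_inj/funext => k.
rewrite (raddf_sum val) fct_sumE/=.
have [kn|nk] := ltnP k n.
  rewrite (bigD1 (Ordinal kn))//= big1 ?addr0.
    rewrite indicE mem_set// mul1r.
    by rewrite [RHS](_ : _ = x k * (k == k)%:R)// eqxx mulr1.
  move=> j jk; rewrite [LHS](_ : _ = x j * (k == j)%:R)//.
  rewrite (_ : k == j = false) ?mulr0//.
  by apply: contraNF jk => /eqP kj; apply/eqP/val_inj.
rewrite indicE memNset ?mul0r/=; last by rewrite ltnNge nk.
rewrite big1// => j _; rewrite [LHS](_ : _ = x j * (k == j)%:R)//.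
by rewrite gtn_eqF ?mulr0// (leq_trans (ltn_ord j)).
Qed.

Lemma l2_tail_cvg x :
  l2_norm (x - ind_mul `I_n x) ^+ 2 @[n --> \oo] --> (0 : R).
Proof.
set s := series (fun j => mu j * normc (x j) ^+ 2).
have cx : s @ \oo --> _ := @l2_normE R mu mu_ge0 x.
suff E n : l2_norm (x - ind_mul `I_n x) ^+ 2 = l2_norm x ^+ 2 - s n.
  rewrite (eq_cvg _ _ E).
  have := cvgB (cvg_cst (l2_norm x ^+ 2)) cx.
  by rewrite subrr => h; exact: h.
have dE j : (x - ind_mul `I_n x) j = x j - \1_(`I_n) j * x j by [].
have cy := @l2_normE R mu mu_ge0 (x - ind_mul `I_n x).
have tail : s k - s n @[k --> \oo] --> l2_norm x ^+ 2 - s n.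
  exact: cvgB cx (cvg_cst _).
rewrite -(cvg_lim _ cy)//; apply/cvg_lim => //.
apply: cvg_trans tail; apply: near_eq_cvg.
exists n => // k nk.
rewrite sub_series_geq// [in RHS]/series [RHS](big_cat_nat (n := n))//.
rewrite [X in _ = X + _]big_nat [X in _ = X + _]big1 ?add0r.
  apply: eq_big_nat => j /andP[nj _]; congr (_ * _ ^+ 2).
  by rewrite dE indicE memNset ?mul0r ?subr0//= ltnNge nj.
move=> j jn.
by rewrite dE indicE mem_set//= mul1r subrr normc0 expr0n mulr0.
Qed.

(* A bounded operator has exactly one family of matrix entries. *)
Lemma matrix_entries_basis (W : {linear l2 mu -> l2 mu}) :
  bounded_operator W -> matrix_entries W (fun k j => W (l2_basis j) k).
Proof.
move=> [M WM] x k.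
pose c := M ^+ 2 / mu k.
apply: (@cvg_complex_sqr _ _ _ c _ _ (l2_tail_cvg x)) => n.
rewrite (_ : _ - _ = W (x - ind_mul `I_n x) k).
  rewrite /c mulrAC ler_pdivlMr// mulrC (le_trans (l2_coord_le _ _))//.
  rewrite -exprMn lerXn2r// nnegrE ?l2_norm_ge0//.
  by rewrite (le_trans _ (WM _)) ?l2_norm_ge0.
rewrite linearB/= [RHS](_ : _ = W x k - W (ind_mul `I_n x) k)//.
congr (_ - _); rewrite ind_mul_truncE linear_sum/=.
rewrite l2_sumE /series/= big_mkord; apply: eq_bigr => j _.
by rewrite linearZ/= mulrC.
Qed.

Lemma matrix_entries_uniq (W : l2 mu -> l2 mu) a :
  matrix_entries W a -> forall k j, a k j = W (l2_basis j) k.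
Proof.
move=> aW k j.
have aj := aW (l2_basis j) k.
rewrite -(cvg_lim _ aj); last exact: norm_hausdorff.
apply/esym/(@cvg_lim (R[i]^o)); first exact: norm_hausdorff.
apply: cvg_near_cst.
exists j.+1 => // n /= jn; rewrite /series/= big_mkord.
rewrite (bigD1 (Ordinal jn))//= eqxx mulr1 big1 ?addr0// => i ij.
rewrite (_ : _ == _ = false) ?mulr0//.
by apply: contraNF ij => /eqP ij; apply/eqP/val_inj.
Qed.
End matrix_entries_existence.

Definition wt (R : realType) (mu : nat -> R) (X : set nat) : \bar R :=
  \esum_(j in X) (mu j)%:E.

(* Blocks may be empty, hence [cover] and [trivIset] rather than [partition]. *)
Definition finite_partition (J : nat) (Y : 'I_J.+1 -> set nat) : Prop :=
  cover [set: 'I_J.+1] Y = [set: nat] /\ trivIset [set: 'I_J.+1] Y.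

Definition M_part (R : realType) (mu : nat -> R) (A : l2 mu -> l2 mu)
    (J : nat) (Y : 'I_J.+1 -> set nat) : \bar R :=
  (\sum_(j < J.+1) wt mu (Y j) * op_norm (A \o ind_mul (Y j)) ^+ 2)%E.

Definition mu_norm (R : realType) (mu : nat -> R) (A : l2 mu -> l2 mu) :
    \bar R :=
  ereal_inf [set r | exists J (Y : 'I_J.+1 -> set nat),
    finite_partition Y /\ r = sqrte (M_part A Y)].

(* Main.v *)
(* Let e_j be the j-th standard basis vector. By Tonelli the double sum is
   S = sum_j |W e_j|^2. Testing W 1_Y on the unit vector e_j / sqrt (mu j)
   gives |W e_j|^2 <= mu j * |W 1_Y|^2 for j in Y, with equality if Y = {j};
   summing over the blocks, S <= M_chi(W) for every partition chi.
   Conversely the partition {0}, ..., {n-1}, {n, n+1, ...} gives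
   M_chi(W) <= S + mu {n, n+1, ...} * |W|^2, which tends to S; for n = 0 it
   is the trivial partition, and gives |W|_mu <= |W|. *)

Require Import Defs.
From HB Require Import structures.
From mathcomp Require Import all_boot all_order all_algebra.
From mathcomp Require Import complex.
From mathcomp Require Import all_classical all_reals all_analysis.

Set Implicit Arguments.
Unset Strict Implicit.
Unset Printing Implicit Defensive.

Import Order.TTheory GRing.Theory Num.Theory.
Import numFieldNormedType.Exports.
Import ComplexField.Normc.

Local Open Scope classical_set_scope.
Local Open Scope ring_scope.
Local Open Scope complex_scope.

(** Undoes the normalisation of e_k to a unit vector, with [c] the weight [mu k]. *)
Lemma mulr_sqr_sqrtV (R : rcfType) (c t : R) :
  0 < c -> c * ((Num.sqrt c)^-1 * t) ^+ 2 = t ^+ 2.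
Proof.
by move=> c0; rewrite exprMn exprVn sqr_sqrtr ?ltW// mulVKf// gt_eqF.
Qed.

(** * Unordered sums of nonnegative terms *)

Lemma esum_EFin_series (R : realType) (u : nat -> R) (l : R) :
  (forall j, 0 <= u j) -> series u @ \oo --> l ->
  \esum_(j in [set: nat]) (u j)%:E = l%:E.
Proof.
move=> u0 ul; rewrite -nneseries_esumT; last by move=> j; rewrite lee_fin.
apply/cvg_lim => //.
rewrite (_ : (fun n => _) = EFin \o series u).
  by apply: continuous_cvg ul.
by apply/funext => n /=; rewrite sumEFin.
Qed.

Lemma esumZl (R : realType) (Y : set nat) (c : R) (u : nat -> \bar R) :
  (forall j, 0 <= u j)%E -> 0 <= c ->
  (\esum_(j in Y) (c%:E * u j) = c%:E * \esum_(j in Y) u j)%E.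
Proof.
(* Writing [Y] through its membership predicate turns the unordered sum into a series, where scaling
   is known. *)
move=> u0 c0; rewrite -[Y]set_mem_set -!nneseries_esum//; first last.
  by move=> j _; rewrite mule_ge0.
exact: nneseriesZl.
Qed.

(** Extend each block sum by zero and exchange the sums: every [j] lies in exactly one block, so a
    single term survives. *)
Lemma esum_partition (R : realType) (J : nat) (Y : 'I_J.+1 -> set nat)
    (u : nat -> \bar R) :
  finite_partition Y -> (forall j, 0 <= u j)%E ->
  (\esum_(j in [set: nat]) u j = \sum_(i < J.+1) \esum_(j in Y i) u j)%E.
Proof.
move=> [cY tY] u0.
under [RHS]eq_bigr do rewrite esum_mkcond.
rewrite -esum_sum; last by move=> j i _ _; case: ifP.
apply: eq_esum => j _.
have [i _ Yij] : cover [set: 'I_J.+1] Y j by rewrite cY.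
rewrite (bigD1 i)//= mem_set// big1 ?adde0// => k ki.
rewrite memNset// => Ykj.
by move/eqP: ki; apply; apply: (tY) => //; exists j.
Qed.

(** * The partition into n singletons and a tail *)

(** As fibres of the map sending k to min(k, n), the blocks {0}, ..., {n-1}, {n, n+1, ...} are
    disjoint and cover without case analysis. *)
Definition head_tail_partition (n : nat) (i : 'I_n.+1) : set nat :=
  [set k | minn k n = i].

Lemma head_tail_partitionP n : finite_partition (@head_tail_partition n).
Proof.
split; last by move=> i j _ _ [k [/= ki kj]]; apply/val_inj; rewrite /= -ki -kj.
apply/seteqP; split => // k _.
have kn : (minn k n < n.+1)%N by rewrite ltnS geq_minr.
by exists (Ordinal kn).
Qed.

Lemma head_tail_partition_head n (i : 'I_n) :
  head_tail_partition (widen_ord (leqnSn n) i) = [set val i].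
Proof.
apply/seteqP; split => k; rewrite /head_tail_partition/=.
  by rewrite /minn; case: ltnP => // _ ni; have := ltn_ord i; rewrite -ni ltnn.
by move=> ->; rewrite (minn_idPl _)// ltnW.
Qed.

(** * Norms of vectors *)

Section l2_norm.
Context {R : realType} {mu : nat -> R} (mu_gt0 : forall j, 0 < mu j).
Implicit Types (x : l2 mu) (X : set nat).

Let mu_ge0 j : 0 <= mu j. Proof. exact: ltW. Qed.

(** Trades the limit for an unordered sum, to which termwise comparison and Tonelli apply. *)
Lemma l2_norm_esum x :
  \esum_(j in [set: nat]) (mu j * normc (x j) ^+ 2)%:E = (l2_norm x ^+ 2)%:E.
Proof.
apply: esum_EFin_series; last exact: l2_normE.
by move=> j; rewrite mulr_ge0// sqr_ge0.
Qed.

Lemma l2_normZ (a : R[i]) x : l2_norm (a *: x) = normc a * l2_norm x.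
Proof.
apply/eqP; rewrite -(@eqrXn2 _ 2)// ?mulr_ge0 ?l2_norm_ge0 ?normc_ge0//.
rewrite (exprMn _ (normc a)) -eqe [eqbRHS]EFinM -!l2_norm_esum.
rewrite -esumZl ?sqr_ge0//; last first.
  by move=> j; rewrite lee_fin mulr_ge0// sqr_ge0.
apply/eqP/eq_esum => j _; rewrite -EFinM; congr EFin.
by rewrite (_ : (a *: x) j = a * x j)// normcM exprMn mulrCA.
Qed.

Lemma l2_norm_ind_mul X x : l2_norm (ind_mul X x) <= l2_norm x.
Proof.
rewrite -(@ler_pXn2r _ 2) ?nnegrE ?l2_norm_ge0// -lee_fin -!l2_norm_esum.
apply: le_esum => j _; rewrite lee_fin ler_wpM2l//.
rewrite [X in normc X]/= normcM exprMn indicE; case: (_ \in _).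
  by rewrite normc1 expr1n mul1r.
by rewrite normc0 expr0n mul0r sqr_ge0.
Qed.

Lemma l2_norm_basis k : l2_norm (l2_basis k : l2 mu) = Num.sqrt (mu k).
Proof.
apply/eqP; rewrite -(@eqrXn2 _ 2)// ?l2_norm_ge0 ?sqrtr_ge0//
  (@sqr_sqrtr _ (mu k))//.
rewrite -eqe -l2_norm_esum (esumID [set k])//; last first.
  by move=> j _; rewrite lee_fin mulr_ge0// sqr_ge0.
rewrite setTI esum_set1/=; last by rewrite lee_fin mulr_ge0// sqr_ge0.
rewrite eqxx normc1 expr1n mulr1.
rewrite esum1 ?adde0// => j [_ /= /eqP/negbTE ->].
by rewrite normc0 expr0n mulr0.
Qed.

Lemma ind_mul_basis X k : X k -> ind_mul X (l2_basis k) = l2_basis k :> l2 mu.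
Proof.
move=> Xk; apply/val_inj/funext => j /=.
have [->|_] := eqVneq j k; last by rewrite mulr0.
by rewrite indicE mem_set// mul1r.
Qed.

Lemma ind_mul_set1 k x : ind_mul [set k] x = x k *: l2_basis k.
Proof.
apply/val_inj/funext => j /=; rewrite [RHS](_ : _ = x k * (j == k)%:R)//.
rewrite indicE in_set1 mulrC.
by have [->//|_] := eqVneq j k; rewrite !mulr0.
Qed.

(** * Operator norms *)

Lemma op_norm_ge (A : l2 mu -> l2 mu) x :
  l2_norm x <= 1 -> ((l2_norm (A x))%:E <= op_norm A)%E.
Proof. by move=> x1; apply: ereal_sup_ubound; exists x. Qed.

Lemma op_norm_ge0 (A : l2 mu -> l2 mu) : (0 <= op_norm A)%E.
Proof.
apply: le_trans (op_norm_ge (x := 0) A _); first by rewrite lee_fin l2_norm_ge0.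
by rewrite -(scale0r 0) l2_normZ normc0 mul0r.
Qed.

Lemma op_norm_lty (A : l2 mu -> l2 mu) :
  bounded_operator A -> (op_norm A < +oo)%E.
Proof.
(* With the absolute value of [M], no sign of [M] has to be established. *)
move=> [M AM]; apply: (@le_lt_trans _ _ `|M|%:E); last exact: ltry.
apply: ge_ereal_sup => _ [x /= x1 <-]; rewrite lee_fin (le_trans (AM x))//.
rewrite (le_trans (ler_norm _))// normrM ler_piMr//.
by rewrite ger0_norm ?l2_norm_ge0.
Qed.

(** Multiplication by an indicator maps the unit ball into itself. *)
Lemma op_norm_comp_ind_mul X (A : l2 mu -> l2 mu) :
  (op_norm (A \o ind_mul X) <= op_norm A)%E.
Proof.
apply: ge_ereal_sup => _ [x /= x1 <-]; apply: op_norm_ge.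
exact: le_trans (l2_norm_ind_mul _ _) x1.
Qed.

(** * Columns and blocks *)

Lemma column_le_op_norm X (A : {linear l2 mu -> l2 mu}) k : X k ->
  ((l2_norm (A (l2_basis k)) ^+ 2)%:E <=
   (mu k)%:E * op_norm (A \o ind_mul X) ^+ 2)%E.
Proof.
move=> Xk; pose s := Num.sqrt (mu k).
have s0 : 0 < s by rewrite sqrtr_gt0.
have ns : normc (s^-1)%:C = s^-1 :> R.
  by rewrite /= expr0n addr0 sqrtr_sqr ger0_norm// invr_ge0 ltW.
(* A unit vector, since e_k has norm [s]; it is fixed by [ind_mul X] because [k] lies in [X]. *)
pose x : l2 mu := (s^-1)%:C *: l2_basis k.
have x1 : l2_norm x = 1.
  by rewrite l2_normZ l2_norm_basis ns mulVf// gt_eqF.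
have := op_norm_ge (A \o ind_mul X) (x := x); rewrite x1 => /(_ (lexx _)).
rewrite /= linearZ/= ind_mul_basis// linearZ/= l2_normZ ns => le_op.
have : ((mu k)%:E * (s^-1 * l2_norm (A (l2_basis k)))%:E ^+ 2 <=
    (mu k)%:E * op_norm (A \o ind_mul X) ^+ 2)%E.
  rewrite lee_wpmul2l ?lee_fin// lee_sqr ?op_norm_ge0//.
  by rewrite lee_fin mulr_ge0 ?l2_norm_ge0// invr_ge0 ltW.
apply: le_trans.
by rewrite -EFin_expe -EFinM lee_fin mulr_sqr_sqrtV.
Qed.

(** The operator sends x to x_k A e_k, and mu_k |x_k|^2 <= |x|^2 <= 1 bounds |x_k| by 1 / sqrt(mu_k)
    on the unit ball. *)
Lemma op_norm_column_le (A : {linear l2 mu -> l2 mu}) k :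
  ((mu k)%:E * op_norm (A \o ind_mul [set k]) ^+ 2 <=
   (l2_norm (A (l2_basis k)) ^+ 2)%:E)%E.
Proof.
pose s := Num.sqrt (mu k).
have s0 : 0 < s by rewrite sqrtr_gt0.
have : (op_norm (A \o ind_mul [set k]) <=
    (s^-1 * l2_norm (A (l2_basis k)))%:E)%E.
  apply: ge_ereal_sup => _ [x /= x1 <-].
  rewrite ind_mul_set1 linearZ/= l2_normZ lee_fin ler_wpM2r ?l2_norm_ge0//.
  rewrite -[leRHS]mul1r ler_pdivlMr// -(@ler_pXn2r _ 2)//; last 2 first.
  - by rewrite nnegrE mulr_ge0 ?normc_ge0// ltW.
  - by rewrite nnegrE.
  rewrite exprMn sqr_sqrtr// mulrC (le_trans (l2_coord_le mu_gt0 _ _))//.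
  by rewrite lerXn2r// ?nnegrE ?l2_norm_ge0.
move=> le_op.
have : ((mu k)%:E * op_norm (A \o ind_mul [set k]) ^+ 2 <=
    (mu k)%:E * (s^-1 * l2_norm (A (l2_basis k)))%:E ^+ 2)%E.
  rewrite lee_wpmul2l ?lee_fin// lee_sqr ?op_norm_ge0//.
  by rewrite lee_fin mulr_ge0 ?l2_norm_ge0// invr_ge0 ltW.
move=> /le_trans; apply.
by rewrite -EFin_expe -EFinM lee_fin mulr_sqr_sqrtV.
Qed.

Lemma column_sum_le_M_part (A : {linear l2 mu -> l2 mu}) (J : nat)
    (Y : 'I_J.+1 -> set nat) : bounded_operator A -> finite_partition Y ->
  (\esum_(j in [set: nat]) (l2_norm (A (l2_basis j)) ^+ 2)%:E <=
   M_part A Y)%E.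
Proof.
move=> bA pY; rewrite (esum_partition pY); last first.
  by move=> j; rewrite lee_fin sqr_ge0.
apply: lee_sum => i _; set p := op_norm _.
have p0 : (0 <= p)%E := op_norm_ge0 _.
(* Boundedness makes [p] finite, so its square is a real factor that [esumZl] moves inside the sum
   defining the weight; the comparison is then column by column. *)
have pE : p = (fine p)%:E.
  rewrite fineK// ge0_fin_numE//.
  exact: le_lt_trans (op_norm_comp_ind_mul _ _) (op_norm_lty bA).
rewrite pE -EFin_expe /wt muleC -esumZl ?sqr_ge0//.
by apply: le_esum => j Yij;
  rewrite (EFin_expe (fine p)) -pE muleC column_le_op_norm.
Qed.

(** The singletons carry mu_0 + ... + mu_(n-1), a finite part of the total mass 1 that can be
    subtracted. *)
Lemma wt_head_tail_partition_tail n : series mu @ \oo --> (1 : R) ->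
  wt mu (head_tail_partition (@ord_max n)) = (1 - series mu n)%:E.
Proof.
move=> mu1; have := esum_EFin_series mu_ge0 mu1.
rewrite (esum_partition (head_tail_partitionP n)); last first.
  by move=> j; rewrite lee_fin.
rewrite big_ord_recr/=.
under eq_bigr => i _.
  rewrite head_tail_partition_head esum_set1 ?lee_fin//.
  over.
rewrite sumEFin /series/= big_mkord => mu1E.
by rewrite EFinB -mu1E addeAC subee// add0e.
Qed.

(** The singleton blocks contribute at most a partial sum of the column series; on the tail block
    the norm is at most that of [A]. *)
Lemma M_part_head_tail_le (A : {linear l2 mu -> l2 mu}) n :
  series mu @ \oo --> (1 : R) ->
  (M_part A (@head_tail_partition n) <=
   \esum_(j in [set: nat]) (l2_norm (A (l2_basis j)) ^+ 2)%:E +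
   (1 - series mu n)%:E * op_norm A ^+ 2)%E.
Proof.
move=> mu1; rewrite /M_part big_ord_recr/= leeD//; last first.
  rewrite wt_head_tail_partition_tail// lee_wpmul2l//.
    (* The factor is nonnegative because it is the weight of the tail. *)
    rewrite -wt_head_tail_partition_tail//; apply: esum_ge0 => j _.
    by rewrite lee_fin.
  by rewrite lee_sqr ?op_norm_ge0// op_norm_comp_ind_mul.
rewrite -nneseries_esumT; last by move=> j; rewrite lee_fin sqr_ge0.
apply: le_trans (nneseries_lim_ge n _); last first.
  by move=> j _; rewrite lee_fin sqr_ge0.
rewrite big_mkord; apply: lee_sum => i _.
rewrite head_tail_partition_head /wt esum_set1 ?lee_fin//.
exact: op_norm_column_le.
Qed.

(** * The mu-norm *)

Lemma mu_norm_le_op_norm (A : {linear l2 mu -> l2 mu}) :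
  series mu @ \oo --> (1 : R) -> (mu_norm A <= op_norm A)%E.
Proof.
move=> mu1; apply: ge_ereal_inf.
exists (sqrte (M_part A (@head_tail_partition 0))).
  exists 0%N, (@head_tail_partition 0); split=> //.
  exact: head_tail_partitionP.
have p0 := op_norm_ge0 A.
rewrite -[leRHS](gee0_abs p0) -sqrte_sqr lee_sqrt ?expe_ge0//.
(* For n = 0 the only block is the tail, of weight 1 minus an empty sum. *)
rewrite /M_part big_ord1 (_ : ord0 = ord_max); last exact/val_inj.
rewrite wt_head_tail_partition_tail// /series/= big_geq// subr0 mul1e.
by rewrite lee_sqr ?op_norm_ge0// op_norm_comp_ind_mul.
Qed.

Lemma mu_norm_sqr (A : {linear l2 mu -> l2 mu}) :
  series mu @ \oo --> (1 : R) -> bounded_operator A ->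
  (mu_norm A ^+ 2 =
   \esum_(j in [set: nat]) (l2_norm (A (l2_basis j)) ^+ 2)%:E)%E.
Proof.
move=> mu1 bA; set S := esum _ _.
have S0 : (0 <= S)%E by apply: esum_ge0 => j _; rewrite lee_fin sqr_ge0.
have SM J (Y : 'I_J.+1 -> set nat) : finite_partition Y -> (S <= M_part A Y)%E.
  exact: column_sum_le_M_part.
(* Lower bound: sqrt(S) is below every member of the set whose infimum is taken. *)
have le_mu : (sqrte S <= mu_norm A)%E.
  apply: le_ereal_inf_tmp => _ [J [Y [pY ->]]].
  by rewrite lee_sqrt ?SM// (le_trans S0)// SM.
have mu0 : (0 <= mu_norm A)%E by rewrite (le_trans _ le_mu)// sqrte_ge0.
apply/eqP; rewrite eq_le; apply/andP; split; last first.
  by rewrite -[leLHS]sqr_sqrte// lee_sqr ?sqrte_ge0.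
have opE : op_norm A = (fine (op_norm A))%:E.
  by rewrite fineK// ge0_fin_numE ?op_norm_ge0// op_norm_lty.
(* The excess of the head-tail partition over S vanishes: its weight tends to 0 and the operator
   norm is finite. *)
have tail0 : (1 - series mu n) * fine (op_norm A) ^+ 2 @[n --> \oo] --> (0 : R).
  rewrite -[X in _ --> X](_ : (1 - 1) * fine (op_norm A) ^+ 2 = 0).
    by apply: cvgM; [apply: cvgB => //; exact: cvg_cst|exact: cvg_cst].
  by rewrite subrr mul0r.
(* Upper bound up to [e]: choose n with excess at most [e] and test the infimum on that
   partition. *)
apply/lee_addgt0Pr => e e0.
have /cvgrPdist_lt/(_ _ e0)[n _ /(_ n (leqnn n))] := tail0.
rewrite sub0r normrN => /(le_lt_trans (ler_norm _))/ltW le_e.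
have M0 : (0 <= M_part A (@head_tail_partition n))%E.
  by rewrite (le_trans S0)// SM//; exact: head_tail_partitionP.
have : (mu_norm A <= sqrte (M_part A (@head_tail_partition n)))%E.
  apply: ereal_inf_lbound; exists n, (@head_tail_partition n); split=> //.
  exact: head_tail_partitionP.
rewrite -lee_sqr ?sqrte_ge0// sqr_sqrte// => /le_trans; apply.
apply: le_trans (M_part_head_tail_le A n mu1) _.
by rewrite leeD2l// opE -EFin_expe -EFinM lee_fin.
Qed.

End l2_norm.

Theorem lemma2p3 (R : realType) (mu : nat -> R)
    (mu_gt0 : forall j : nat, 0 < mu j)
    (mu_sum1 : series mu @ \oo --> (1 : R))
    (W : {linear l2 mu -> l2 mu}) (W_bounded : bounded_operator W)
    (w : nat -> nat -> R[i]) (w_entries : matrix_entries W w) :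
  (mu_norm W ^+ 2)%E =
    \esum_(kj in [set: nat * nat])
      (mu kj.1 * normc (w kj.1 kj.2) ^+ 2)%:E
  /\ (mu_norm W <= op_norm W)%E /\ (op_norm W < +oo)%E.
Proof.
split; last by split; [exact: mu_norm_le_op_norm | exact: op_norm_lty].
rewrite mu_norm_sqr//.
have wE := matrix_entries_uniq w_entries.
(* Each squared column norm is expanded over the rows k, and uniqueness of matrix entries puts
   [w k j] for the coordinates of W e_j. *)
under eq_esum => j _.
  rewrite -l2_norm_esum//.
  under eq_esum do rewrite -wE.
  over.
rewrite (esum_esum (J := fun=> [set: nat])); last first.
  by move=> j k _ _; rewrite lee_fin mulr_ge0 ?sqr_ge0// ltW.
(* Tonelli has produced pairs (column, row), while the goal has (row, column); the swap is a
   bijection between them. *)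
rewrite [RHS](@reindex_esum _ _ _ ([set: nat] `*`` fun=> [set: nat]) setT
  (fun p => (p.2, p.1)))//.
split=> // [[j k] [j' k'] _ _ [-> ->]//|[k j] _].
by exists (j, k).
Qed.
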